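(* Let $d\ge2$ and $s=(s_1,\dots,s_{d-1},p)\in\mathbb{C}^d$. Then $s\in\mathbb{G}_d$ if and only if $|\Phi_\alpha(s)|<1$ for every $\alpha\in\overline{\mathbb{D}}$.
   Context: $\mathbb{D}$ is the open unit disc in $\mathbb{C}$. Symmetrized polydisc: $\mathbb{G}_d=\{(e_1(z),\dots,e_d(z)): z\in\mathbb{D}^d\}\subset\mathbb{C}^d$, where $e_i(z)=\sum_{1\le \ell_1<\dots<\ell_i\le d}z_{\ell_1}\cdots z_{\ell_i}$. For $s=(s_1,\dots,s_{d-1},p)\in\mathbb{C}^d$, with $s_0=1$ and $s_d=p$, define polynomials in $\alpha$ $$Q(s)(\alpha)=\sum_{j=1}^{d}(-1)^j j\,s_j\,\alpha^{j-1}=d(-1)^dp\,\alpha^{d-1}+(d-1)(-1)^{d-1}s_{d-1}\alpha^{d-2}+\dots+(-s_1),$$ $$R(s)(\alpha)=\sum_{j=0}^{d-1}(-1)^j(d-j)\,s_j\,\alpha^j=d-(d-1)s_1\alpha+\dots+(-1)^{d-1}s_{d-1}\alpha^{d-1}.$$ Since $R(s)(0)=d\neq0$, $J(s)=Q(s)/R(s)$ is a well-defined rational function of $\alpha$, and $\Phi_\alpha(s)$ denotes its value at $\alpha$: if $R(s)$ and $Q(s)$ have a common zero at $\alpha$, the value is that of the rational function in lowest terms (removable singularities are removed), and $|\Phi_\alpha(s)|=\infty$ at a pole. *)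

(* Defs.v *)
From HB Require Import structures.
From mathcomp Require Import all_boot all_order all_algebra.
From mathcomp Require Import boolp classical_sets reals constructive_ereal.
From mathcomp Require Import complex.

Set Implicit Arguments.
Unset Strict Implicit.
Unset Printing Implicit Defensive.

Import Order.TTheory GRing.Theory Num.Theory.

Local Open Scope classical_set_scope.
Local Open Scope ring_scope.

Section SymmetrizedPolydisc.
Variables (R : realType) (d : nat).
Local Notation C := R[i].

Definition elem_sym (i : nat) (z : 'rV[C]_d) : C :=
  \sum_(A : {set 'I_d} | #|A| == i) \prod_(l in A) z ord0 l.

Definition polydisc : set 'rV[C]_d := [set z | forall l, `|z ord0 l| < 1].

(* Columns are numbered from 0, so column i holds e_{i+1}. *)
Definition symmetrized_polydisc : set 'rV[C]_d :=
  [set \row_(i < d) elem_sym i.+1 z | z in polydisc].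

(* Writing s = (s_1, ..., s_{d-1}, p), scoef s j is s_j for 0 <= j <= d, with
   s_0 = 1 and s_d = p; its values for j > d are never used. *)
Definition scoef (s : 'rV[C]_d) (j : nat) : C :=
  if j is k.+1 then (if insub k is Some i then s ord0 i else 0) else 1.

Definition Qpoly (s : 'rV[C]_d) : {poly C} :=
  \sum_(1 <= j < d.+1) ((-1) ^+ j * j%:R * scoef s j) *: 'X^(j.-1).

Definition Rpoly (s : 'rV[C]_d) : {poly C} :=
  \sum_(0 <= j < d) ((-1) ^+ j * (d - j)%:R * scoef s j) *: 'X^j.

End SymmetrizedPolydisc.

Arguments polydisc R d : clear implicits.
Arguments symmetrized_polydisc R d : clear implicits.

(* The value at a of the rational function p / q (q != 0), put in lowest terms
   first; None stands for the point at infinity, taken at poles. *)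
Definition ratfun_value (F : fieldType) (p q : {poly F}) (a : F) : option F :=
  let num := p %/ gcdp p q in
  let den := q %/ gcdp p q in
  if root den a then None else Some (num.[a] / den.[a]).

Definition Phi (R : realType) (d : nat) (a : R[i]) (s : 'rV[R[i]]_d) :
    option R[i] :=
  ratfun_value (Qpoly s) (Rpoly s) a.

(* The modulus on the Riemann sphere: the norm of R[i] takes its values in R[i]
   and is real, so Re recovers it as an element of R. *)
Definition sphere_norm (R : realType) (w : option R[i]) : \bar R :=
  if w is Some z then (complex.Re `|z|)%:E else +oo%E.

(* Main.v *)
(* With P = sum_j (-1)^j s_j X^j one has Q = P' and R = d P - X P', and s lies
   in the symmetrized polydisc iff P = prod_l (1 - z_l X) with all |z_l| < 1,
   i.e. iff P has no root in the closed disc.  At a root a of P, Phi_a = -1/a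
   after cancellation, so |Phi_a| >= 1 if |a| <= 1.  If P = prod_l (1 - z_l X),
   put b_l = z_l / (1 - z_l a) and S = sum_l b_l; then -Q/P = S and
   R/P = d + a S at a, while |b_l| < |1 + a b_l|.  This last condition is convex
   in b_l when |a| <= 1, so it holds for the mean S / d, i.e. |Q| < |R|. *)
Require Import Defs.
From mathcomp Require Import all_boot all_order all_algebra.
From mathcomp Require Import boolp classical_sets reals constructive_ereal.
From mathcomp Require Import complex ring.

Set Implicit Arguments.
Unset Strict Implicit.
Unset Printing Implicit Defensive.

Import Order.TTheory GRing.Theory Num.Theory.
Local Open Scope ring_scope.

Section RationalFunctionValue.
Variable F : fieldType.
Implicit Types p q c : {poly F}.

(** The reduced fraction satisfies [p' * q = q' * p], so a zero of [q'] at [a] would also be one of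
    [p'], against coprimality. Hence [Phi] can be evaluated from any common factor [c] that leaves a
    denominator nonzero at [a], without computing the gcd. *)
Lemma ratfun_value_cancel c p q (a : F) :
  c != 0 -> ~~ root q a ->
  ratfun_value (p * c) (q * c) a = Some (p.[a] / q.[a]).
Proof.
move=> c0 qa; rewrite /ratfun_value.
have q0 : q != 0 by apply: contraNneq qa => ->; rewrite root0.
set g := gcdp (p * c) (q * c).
have qc0 : q * c != 0 by rewrite mulf_neq0.
have g0 : g != 0 by rewrite gcdp_eq0 negb_and qc0 orbT.
set p' := (p * c) %/ g; set q' := (q * c) %/ g.
have ep : p * c = p' * g by rewrite divpK // dvdp_gcdl.
have eq : q * c = q' * g by rewrite divpK // dvdp_gcdr.
have cop : coprimep p' q' by apply: coprimep_div_gcd; rewrite qc0 orbT.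
have cross : p' * q = q' * p.
  apply: (mulIf (mulf_neq0 g0 c0)).
  have -> : p' * q * (g * c) = (p' * g) * (q * c) by ring.
  by rewrite -ep eq; ring.
have /(congr1 (horner^~ a)) := cross; rewrite /= !hornerM => crossa.
have q'a : ~~ root q' a.
  apply/negP => q'a.
  have : p'.[a] * q.[a] = 0 by rewrite crossa (rootP q'a) mul0r.
  move/eqP; rewrite mulf_eq0 (rootPf qa) orbF => p'a.
  by move: (coprimep_root cop p'a); rewrite (rootP q'a) eqxx.
rewrite (negPf q'a); congr Some; apply/eqP.
by rewrite eqr_div ?crossa 1?mulrC //; apply: contraNneq.
Qed.

End RationalFunctionValue.

(** The logarithmic derivative of a product is the sum of those of its factors. *)
Lemma deriv_prod_1subZX (F : fieldType) (I : Type) (r : seq I) (z : I -> F)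
    (a : F) :
  (forall l, 1 - z l * a != 0) ->
  (\prod_(l <- r) (1 - z l *: 'X))^`().[a] =
  - ((\prod_(l <- r) (1 - z l *: 'X)).[a] * \sum_(l <- r) z l / (1 - z l * a)).
Proof.
move=> nz; elim: r => [|l r IH].
  by rewrite !big_nil mulr0 oppr0 -polyC1 derivC horner0.
have dl : (1 - z l *: 'X)^`() = (- z l)%:P.
  by rewrite derivB -polyC1 derivC derivZ derivX sub0r alg_polyC polyCN.
rewrite !big_cons derivM dl !hornerE IH.
by field; exact: nz.
Qed.

(** Vieta's formula: expand the product over subsets [A] of the indices; only those of cardinality
    [j] contribute to the coefficient of ['X^j]. *)
Lemma coef_prod_1subZX (R : realType) (d j : nat) (z : 'rV[R[i]]_d) :
  (\prod_(l < d) (1 - z ord0 l *: 'X))`_j = (-1) ^+ j * elem_sym j z.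
Proof.
rewrite -(eq_bigr _ (fun l _ => addrC (- (z ord0 l *: 'X)) 1)) bigA_distr.
rewrite coef_sum /elem_sym mulr_sumr [RHS]big_mkcond /=.
apply: eq_bigr => A _.
rewrite -big_mkcond /= (eq_bigr (fun l => (- z ord0 l)%:P * 'X)); last first.
  by move=> l _; rewrite mul_polyC scaleNr.
rewrite big_split /= prodr_const -rmorph_prod mul_polyC coefZ coefXn eq_sym.
case: eqP => [<-|_]; last by rewrite mulr0.
by rewrite mulr1 prodrN.
Qed.

Section CharacteristicPolynomial.
Variables (R : realType) (d : nat).
Local Notation C := R[i].
Implicit Types (s z : 'rV[C]_d) (a : C).

Definition Ppoly s : {poly C} := \poly_(j < d.+1) ((-1) ^+ j * scoef s j).

Lemma Ppoly_0 s : (Ppoly s).[0] = 1.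
Proof. by rewrite horner_coef0 coef_poly /= mulr1. Qed.

Lemma Qpoly_deriv s : Qpoly s = (Ppoly s)^`().
Proof.
rewrite /Qpoly big_add1 /= big_mkord.
rewrite -(poly_def d (fun j => (-1) ^+ j.+1 * j.+1%:R * scoef s j.+1)).
apply/polyP => i.
rewrite coef_deriv !coef_poly ltnS; case: ifP => _; last by rewrite mul0rn.
by rewrite mulrAC mulr_natr.
Qed.

Lemma Rpoly_deriv s : Rpoly s = (Ppoly s) *+ d - (Ppoly s)^`() * 'X.
Proof.
rewrite /Rpoly big_mkord.
rewrite -(poly_def d (fun j => (-1) ^+ j * (d - j)%:R * scoef s j)).
apply/polyP => i.
rewrite coefB coefMn coefMX coef_deriv !coef_poly.
case: i => [|i] /=; first by rewrite subn0 subr0; case: d => //= k; ring.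
(* In degree [d] the two contributions of [s_d] cancel, in accordance with [Rpoly] stopping at
   degree [d - 1]. *)
rewrite !ltnS; case: (ltngtP i.+1 d) => [lt|gt|->] /=.
- by rewrite natrB ?(ltnW lt) //; ring.
- by rewrite !mul0rn subrr.
- by rewrite subrr.
Qed.

(** Both directions compare coefficients through Vieta's formula. *)
Lemma symmetrized_polydiscP s :
  symmetrized_polydisc R d s <->
  exists2 z : 'rV[C]_d, (forall l, `|z ord0 l| < 1) &
    Ppoly s = \prod_(l < d) (1 - z ord0 l *: 'X).
Proof.
split=> [[z zD <-]|[z zD Pz]]; exists z => //.
  apply/polyP => j; rewrite coef_prod_1subZX coef_poly ltnS.
  case: j => [|j] /=.
    rewrite expr0 !mul1r /elem_sym (big_pred1 finset.set0) ?big_set0 //.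
    by move=> A; rewrite cards_eq0.
  case: insubP => [i _ ij|]; first by rewrite -ij ltn_ord mxE.
  (* Beyond degree [d] the sum over subsets is empty, since no subset of ['I_d] is that large. *)
  move=> jd; rewrite (negPf jd) /elem_sym big_pred0 ?mulr0 // => A.
  apply/negbTE; apply: contraNneq jd => <-.
  by rewrite -[X in (_ <= X)%N](card_ord d) max_card.
apply/rowP => i; rewrite mxE.
have := coef_prod_1subZX i.+1 z; rewrite -Pz coef_poly ltnS ltn_ord /=.
rewrite insubT ?ltn_ord //= => Hi h.
move/mulfI: h => <-; last by rewrite signr_eq0.
congr (s _ _); exact: val_inj.
Qed.

(** Replaces the condition on the Riemann sphere by a comparison of norms at [a], once a common
    factor [c] has been split off. *)
Lemma Phi_lt1 a s (c q r : {poly C}) :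
  c != 0 -> Qpoly s = q * c -> Rpoly s = r * c -> r.[a] != 0 ->
  (sphere_norm (Phi a s) < 1)%E = (`|q.[a]| < `|r.[a]|).
Proof.
move=> c0 Qe Re r0; rewrite /Phi Qe Re ratfun_value_cancel //.
rewrite /sphere_norm lte_fin; set w := _ / _.
have -> : (complex.Re `|w| < 1) = (`|w| < 1) by rewrite normc_def -ltcR.
by rewrite normrM normfV ltr_pdivrMr ?mul1r // normr_gt0.
Qed.

(* The condition [|b| < |1 + a b|] is convex when [|a| <= 1]: its two sides squared differ
   by [(1 - |a|^2) |b|^2 - 2 Re (a b) - 1]. *)
Lemma mean_lt (a : C) (b : 'I_d -> C) :
  (0 < d)%N -> `|a| <= 1 -> (forall l, `|b l| < `|1 + a * b l|) ->
  `|\sum_l b l| < `|d%:R + a * \sum_l b l|.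
Proof.
move=> d0 a1 bl; set S := \sum_l b l.
have sumC : \sum_l (b l)^* = S^* by rewrite rmorph_sum.
have sumc (x : C) : \sum_(l < d) x = d%:R * x.
  by rewrite sumr_const card_ord mulr_natl.
set T := \sum_l b l * (b l)^*.
(* Cauchy-Schwarz, from expanding the nonnegative sum of the [|d b_l - S|^2], which equals
   [d (d T - |S|^2)]. *)
have CS : S * S^* <= d%:R * T.
  have : 0 <= \sum_l (d%:R * b l - S) * (d%:R * b l - S)^*.
    by apply: sumr_ge0 => l _; apply: mul_conjC_ge0.
  rewrite (eq_bigr (fun l => d%:R * d%:R * (b l * (b l)^*)
      - (d%:R * S^*) * b l - (d%:R * S) * (b l)^* + S * S^*)); last first.
    by move=> l _; rewrite rmorphB rmorphM /= conjC_nat; ring.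
  rewrite !big_split /= !sumrN -!mulr_sumr sumC sumc -/S -/T.
  have -> : d%:R * d%:R * T - d%:R * S^* * S - d%:R * S * S^* + S * (d%:R * S^*)
    = d%:R * (d%:R * T - S * S^*) by ring.
  by rewrite pmulr_rge0 ?ltr0n // subr_ge0.
have sqlt x y : (`|x| < `|y|) = (x * x^* < y * y^* :> C).
  by rewrite -!normCK ltr_pXn2r ?nnegrE.
have aa : 0 <= 1 - a * a^*.
  by rewrite subr_ge0 -normCK exprn_ile1.
(* The sum over [l] of the squared hypotheses; strictness needs at least one index, which [d0]
   provides. *)
have key : (1 - a * a^*) * T < d%:R + a * S + a^* * S^*.
  have -> : d%:R + a * S + a^* * S^* =
      \sum_l (1 + a * b l + a^* * (b l)^*).
    by rewrite !big_split /= -!mulr_sumr sumC sumc mulr1.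
  rewrite mulr_sumr; apply: ltr_sum => [|l _].
    by apply/hasP; exists (Ordinal d0); rewrite ?mem_index_enum.
  have := bl l; rewrite sqlt rmorphD rmorphM rmorph1 /=.
  by rewrite -subr_gt0 => h; rewrite -subr_gt0 in h; congr (_ < _): h; ring.
rewrite sqlt rmorphD rmorphM /= conjC_nat -subr_gt0.
(* By [CS] and [aa], this difference of squared moduli is at least [d] times the gap in [key]. *)
have -> : (d%:R + a * S) * (d%:R + a^* * S^*) - S * S^* =
  d%:R * (d%:R + a * S + a^* * S^*) - (1 - a * a^*) * (S * S^*) by ring.
rewrite subr_gt0; apply: le_lt_trans (ler_wpM2l aa CS) _.
by rewrite mulrCA ltr_pM2l ?ltr0n.
Qed.

Lemma Phi_lt1_of_prod a s z :
  (0 < d)%N -> (forall l, `|z ord0 l| < 1) ->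
  Ppoly s = \prod_(l < d) (1 - z ord0 l *: 'X) -> `|a| <= 1 ->
  (sphere_norm (Phi a s) < 1)%E.
Proof.
move=> d0 zD Pz a1.
have nz l : 1 - z ord0 l * a != 0.
  rewrite subr_eq0 eq_sym; apply/negP => /eqP e.
  have : `|z ord0 l * a| < 1
    by rewrite normrM (le_lt_trans _ (zD l)) // ler_piMr.
  by rewrite e normr1 ltxx.
pose S := \sum_l z ord0 l / (1 - z ord0 l * a).
have Pa : (Ppoly s).[a] != 0.
  rewrite Pz horner_prod; apply/prodf_neq0 => l _.
  by rewrite !hornerE.
have Qa : (Qpoly s).[a] = - ((Ppoly s).[a] * S).
  by rewrite Qpoly_deriv Pz deriv_prod_1subZX.
have Ra : (Rpoly s).[a] = (Ppoly s).[a] * (d%:R + a * S).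
  rewrite Rpoly_deriv -Qpoly_deriv !hornerE hornerMn Qa; ring.
have lt : `|S| < `|d%:R + a * S|.
  apply: mean_lt => // l; set w := z ord0 l.
  (* Thus [|b_l| = |z_l| |1 + a b_l|] with [b_l = z_l / (1 - z_l a)], and [|z_l| < 1] concludes. *)
  have -> : 1 + a * (w / (1 - w * a)) = 1 / (1 - w * a) by field; exact: nz.
  by rewrite !normrM ltr_pM2r ?normr1 ?zD // normr_gt0 invr_eq0 nz.
(* The strict bound itself excludes a zero of the denominator, so the common factor can be taken to
   be [1]. *)
have r0 : (Rpoly s).[a] != 0.
  by rewrite Ra mulf_neq0 // -normr_gt0 (le_lt_trans _ lt).
rewrite (@Phi_lt1 a s 1 (Qpoly s) (Rpoly s)) ?mulr1 ?oner_neq0 //.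
by rewrite Qa Ra normrN !normrM ltr_pM2l // normr_gt0.
Qed.

(** If [P = g (X - a)^(m+1)] with [g(a)] nonzero, then [(X - a)^m] divides both [Q] and [R]. The
    cofactors take at [a] the values [q(a) = (m+1) g(a)], nonzero in characteristic zero, and
    [- a q(a)]; moreover [a] is nonzero because [P(0) = 1]. *)
Lemma Phi_root a s :
  root (Ppoly s) a -> `|a| <= 1 -> ~ (sphere_norm (Phi a s) < 1)%E.
Proof.
move=> Pa a1.
have P0 : Ppoly s != 0.
  by apply: contra_eq_neq (Ppoly_0 s) => ->; rewrite horner0 eq_sym oner_eq0.
have a0 : a != 0.
  by apply: contraTneq Pa => ->; rewrite /root Ppoly_0 oner_eq0.
have [[|m] [g]] := multiplicity_XsubC (Ppoly s) a; rewrite P0 /= => ga Pg.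
  by move: Pa; rewrite Pg expr0 mulr1 (negPf ga).
pose q := g^`() * ('X - a%:P) + g *+ m.+1.
pose c := ('X - a%:P) ^+ m.
have Qe : Qpoly s = q * c.
  by rewrite Qpoly_deriv Pg derivM deriv_exp derivXsubC /q /c exprS /=; ring.
have Re : Rpoly s = ((g * ('X - a%:P)) *+ d - q * 'X) * c.
  by rewrite Rpoly_deriv -Qpoly_deriv Qe Pg /q /c exprS; ring.
have qa : q.[a] = g.[a] *+ m.+1 by rewrite /q !hornerE hornerMn; ring.
have ra : (g * ('X - a%:P) *+ d - q * 'X).[a] = - (q.[a] * a).
  by rewrite !hornerE hornerMn !hornerE; ring.
have qa0 : q.[a] != 0 by rewrite qa mulrn_eq0.
rewrite (@Phi_lt1 a s c q _ _ Qe Re) ?ra ?oppr_eq0 ?mulf_neq0 //; last first.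
  by rewrite expf_neq0 // polyXsubC_eq0.
by rewrite normrN normrM ltr_pMr ?normr_gt0 // le_gtF.
Qed.

(** Since [C] is algebraically closed, [p] splits; the inverses of its roots, all of modulus greater
    than 1, give the [z_l]. *)
Lemma prod_1subZX_of_rootfree (p : {poly C}) :
  (size p <= d.+1)%N -> p.[0] = 1 -> (forall a, `|a| <= 1 -> ~~ root p a) ->
  exists2 z : 'rV[C]_d, (forall l, `|z ord0 l| < 1) &
    p = \prod_(l < d) (1 - z ord0 l *: 'X).
Proof.
move=> szp p0 rootfree.
have [rs prs] := closed_field_poly_normal p.
have pn0 : p != 0.
  by apply: contra_eq_neq p0 => ->; rewrite horner0 eq_sym oner_eq0.
have lc0 : lead_coef p != 0 by rewrite lead_coef_eq0.
have rs1 r : r \in rs -> 1 < `|r|.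
  move=> rr; rewrite real_ltNge ?normr_real ?real1 //; apply/negP => /rootfree.
  by rewrite prs rootZ // root_prod_XsubC rr.
pose zs := [seq x^-1 | x <- rs].
have pz : p = \prod_(x <- zs) (1 - x *: 'X).
  have rsn0 r : r \in rs -> r != 0.
    by move/rs1 => h; rewrite -normr_gt0 (lt_trans ltr01 h).
  (* Factor by factor, [X - r = - r (1 - r^-1 X)]. *)
  have prod_eq : \prod_(r <- rs) ('X - r%:P) =
      (\prod_(r <- rs) - r) *: \prod_(x <- zs) (1 - x *: 'X).
    rewrite big_map -mul_polyC rmorph_prod -big_split /=.
    apply: eq_big_seq => r /rsn0 r0.
    rewrite mulrBr mulr1 -scalerAr mul_polyC scalerA.
    by rewrite mulrN mulVf // scaleN1r opprK polyCN addrC.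
  rewrite {1}prs prod_eq scalerA.
  (* The scalar left over is [p(0)]. *)
  suff -> : lead_coef p * \prod_(r <- rs) - r = 1 by rewrite scale1r.
  rewrite -[RHS]p0 [in RHS]prs hornerZ horner_prod; congr (_ * _).
  by apply: eq_bigr => r _; rewrite !hornerE.
have szz : (size zs <= d)%N.
  rewrite size_map -ltnS; apply: leq_trans szp.
  by rewrite {1}prs size_scale // size_prod_XsubC.
(* When [p] has degree below [d], the missing entries are the default value [0], which lies in the
   disc and contributes the factor [1]. *)
exists (\row_(l < d) zs`_l) => [l|].
  rewrite mxE; case: (ltnP l (size zs)) => lz; last first.
    by rewrite nth_default // normr0 ltr01.
  have /mapP[r /rs1 r1 ->] := mem_nth 0 lz.
  by rewrite normfV invf_lt1 // (lt_trans ltr01 r1).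
rewrite {1}pz (big_nth 0) big_mkord.
rewrite (big_ord_widen d (fun l => 1 - zs`_l *: 'X)) //.
rewrite big_mkcond; apply: eq_bigr => l _; rewrite mxE; case: ltnP => // lz.
by rewrite nth_default // scale0r subr0.
Qed.

End CharacteristicPolynomial.

Theorem theorem2p1 (R : realType) (d : nat) (hd : (2 <= d)%N)
    (s : 'rV[R[i]]_d) :
  symmetrized_polydisc R d s <->
  (forall a : R[i], `|a| <= 1 -> (sphere_norm (Phi a s) < 1)%E).
Proof.
rewrite symmetrized_polydiscP; split=> [[z zD Pz] a a1|Phi1].
  exact: Phi_lt1_of_prod (ltnW hd) zD Pz a1.
apply: prod_1subZX_of_rootfree; rewrite ?Ppoly_0 ?size_poly // => a a1.
by apply/negP => /Phi_root/(_ a1); apply; apply: Phi1.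
Qed.
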